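(* Let $G$ be an affine algebraic group over $\Bbbk$ acting in a separable way on an affine variety $X$. If the action of $G$ on $X$ is unipotent and linearly reductive, then all the orbits are closed and isomorphic to $G$.
   Context: $\Bbbk$ is an algebraically closed field; all algebras are commutative. Geometric actions are regular and on the right; for such an action of $G$ on an affine variety $X$, $\Bbbk[X]$ is a rational $G$-module algebra via $(g\cdot f)(x)=f(x\cdot g)$. For a rational $G$-module algebra $R$ (commutative $\Bbbk$-algebra and rational $G$-module with $G$ acting by algebra automorphisms), a $(G,R)$-module is a rational $G$-module $M$ that is also an $R$-module with $x\cdot(rm) = (x\cdot r)(x\cdot m)$; morphisms are $G$-equivariant $R$-linear maps; ${}^G M$ is the set of $G$-fixed elements. The action of $G$ on $R$ is linearly reductive if for every $(G,R)$-module $M$, every $G$-stable ideal $J\subseteq R$ and every surjective morphism of $(G,R)$-modules $\lambda: M\to R/J$, there exists $m\in {}^G M$ with $\lambda(m)=1+J$. The action of $G$ on $R$ is unipotent if ${}^G M\neq 0$ for every $(G,R)$-module $M\neq 0$. The action of $G$ on $X$ is linearly reductive (resp. unipotent) if the action of $G$ on $\Bbbk[X]$ is. The action is separable if for every $x\in X$ the orbit morphism $G\to x\cdot G$ is separable. *)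

(* Defs.v *)
From HB Require Import structures.
From mathcomp Require Import all_boot all_algebra.
From mathcomp Require Import separable boolp classical_sets functions.
From mathcomp Require Import mpoly.

Set Implicit Arguments.
Unset Strict Implicit.
Unset Printing Implicit Defensive.

Import GRing.Theory.
Local Open Scope ring_scope.
Local Open Scope classical_set_scope.

(* Varieties in the classical sense: a nonempty set of points together with  *)
(* its algebra of regular functions, a subalgebra of the functions T -> k.   *)
HB.mixin Record isFunctionSpace (k : fieldType) T := {
  regular : {pred T -> k};
  points_neq0 : exists _ : T, True;
  regular_subring : GRing.subring_closed regular;
  regular_cst : forall c : k, cst c \in regular
}.

#[short(type="functionSpaceType")]
HB.structure Definition FunctionSpace (k : fieldType) :=
  {T of isFunctionSpace k T}.

Section CoordinateRing.
Variables (k : fieldType) (X : functionSpaceType k).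

Record coord_ring := Coord { coord_fun :> X -> k; _ : coord_fun \in regular }.

HB.instance Definition _ := [isSub for coord_fun].
HB.instance Definition _ := [Choice of coord_ring by <:].

Lemma coord_ringP (f : coord_ring) : (f : X -> k) \in regular.
Proof. exact: valP. Qed.

HB.instance Definition _ :=
  GRing.SubChoice_isSubComPzRing.Build _ _ coord_ring regular_subring.

Fact coord_1_neq0 : 1 != 0 :> coord_ring.
Proof.
have [x _] := @points_neq0 k X.
by apply/eqP => /(congr1 (fun f : coord_ring => f x))/eqP; rewrite oner_eq0.
Qed.
HB.instance Definition _ :=
  GRing.PzSemiRing_isNonZero.Build coord_ring coord_1_neq0.

Definition coord_cst (c : k) : coord_ring := Coord (regular_cst c).
Definition coord_scale (c : k) (f : coord_ring) : coord_ring := coord_cst c * f.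

Fact coord_scaleA a b f : coord_scale a (coord_scale b f) = coord_scale (a * b) f.
Proof. by apply/val_inj/funext => x; apply: mulrA. Qed.
Fact coord_scale1 : left_id 1 coord_scale.
Proof. by move=> f; apply/val_inj/funext => x; apply: mul1r. Qed.
Fact coord_scaleDr : right_distributive coord_scale +%R.
Proof. by move=> c f g; apply/val_inj/funext => x; apply: mulrDr. Qed.
Fact coord_scaleDl f : {morph coord_scale^~ f : a b / a + b}.
Proof. by move=> a b; apply/val_inj/funext => x; apply: mulrDl. Qed.
HB.instance Definition _ := GRing.Zmodule_isLmodule.Build k coord_ring
  coord_scaleA coord_scale1 coord_scaleDr coord_scaleDl.

Fact coord_scaleAl (c : k) (f g : coord_ring) : c *: (f * g) = c *: f * g.
Proof. exact: mulrA. Qed.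
HB.instance Definition _ := GRing.Lmodule_isLalgebra.Build k coord_ring coord_scaleAl.
HB.instance Definition _ := GRing.Lalgebra_isComAlgebra.Build k coord_ring.

Lemma coord_eqP (f g : coord_ring) : (forall x, f x = g x) <-> f = g.
Proof. by split=> [fg|-> //]; apply/val_inj/funext. Qed.
Lemma coord0E x : (0 : coord_ring) x = 0. Proof. by []. Qed.
Lemma coord1E x : (1 : coord_ring) x = 1. Proof. by []. Qed.
Lemma coordDE (f g : coord_ring) x : (f + g) x = f x + g x. Proof. by []. Qed.
Lemma coordNE (f : coord_ring) x : (- f) x = - f x. Proof. by []. Qed.
Lemma coordBE (f g : coord_ring) x : (f - g) x = f x - g x. Proof. by []. Qed.
Lemma coordME (f g : coord_ring) x : (f * g) x = f x * g x. Proof. by []. Qed.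
Lemma coordZE c (f : coord_ring) x : (c *: f) x = c * f x. Proof. by []. Qed.
Lemma coord_sumE I (r : seq I) (P : pred I) (F : I -> coord_ring) x :
  (\sum_(i <- r | P i) F i) x = \sum_(i <- r | P i) F i x.
Proof. by elim/big_rec2: _ => // i y1 y2 _ <-. Qed.

End CoordinateRing.
Arguments coord_ring {k} X.
(* An affine variety: k[X] is finitely generated, and the points of X are,   *)
(* via evaluation, the k-algebra homomorphisms k[X] -> k.                    *)
HB.mixin Record isAffineVariety (k : fieldType) T of FunctionSpace k T := {
  coord_fingen : exists s : seq (coord_ring T), forall S : {pred coord_ring T},
    GRing.subalg_closed S -> {subset s <= S} -> forall f, f \in S;
  coord_points : forall chi : {lrmorphism coord_ring T -> k^o},
    exists! x : T, forall f : coord_ring T, chi f = f x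
}.

#[short(type="affineVarietyType")]
HB.structure Definition AffineVariety (k : fieldType) :=
  {T of FunctionSpace k T & isAffineVariety k T}.

Section Morphisms.
Variables (k : fieldType) (X Y : functionSpaceType k).

Record variety_morphism := Morphism {
  mor_fun :> X -> Y;
  mor_regular : forall f : coord_ring Y, f \o mor_fun \in regular
}.

Definition pullback (phi : variety_morphism) (f : coord_ring Y) : coord_ring X :=
  Coord (mor_regular phi f).

Variable phi : variety_morphism.
Fact pullback_is_zmod_morphism : zmod_morphism (pullback phi).
Proof. by move=> f g; apply/val_inj. Qed.
Fact pullback_is_monoid_morphism : monoid_morphism (pullback phi).
Proof. by split=> [|f g]; apply/val_inj. Qed.
Fact pullback_is_scalable : scalable (pullback phi).
Proof. by move=> c f; apply/val_inj. Qed.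
HB.instance Definition _ := GRing.isZmodMorphism.Build (coord_ring Y) (coord_ring X)
  (pullback phi) pullback_is_zmod_morphism.
HB.instance Definition _ := GRing.isMonoidMorphism.Build (coord_ring Y) (coord_ring X)
  (pullback phi) pullback_is_monoid_morphism.
HB.instance Definition _ := GRing.isScalable.Build k (coord_ring Y) (coord_ring X) *:%R
  (pullback phi) pullback_is_scalable.

End Morphisms.
Arguments variety_morphism {k} X Y.

Definition variety_isomorphism (k : fieldType) (X Y : functionSpaceType k)
    (phi : variety_morphism X Y) : Prop :=
  exists psi : variety_morphism Y X, cancel phi psi /\ cancel psi phi.

Section Product.
Variable k : fieldType.

Section ProductSpace.
Variables X Y : functionSpaceType k.

(* k[X x Y] is the image of k[X] (x) k[Y]. *)
Definition tensor_fun (s : seq (coord_ring X * coord_ring Y)) (p : X * Y) : k :=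
  \sum_(ab <- s) ab.1 p.1 * ab.2 p.2.

Definition prod_regular : {pred X * Y -> k} :=
  [pred f | `[< exists s, f = tensor_fun s >]].

Fact prod_points_neq0 : exists _ : X * Y, True.
Proof.
by have [[x _] [y _]] := (@points_neq0 k X, @points_neq0 k Y); exists (x, y).
Qed.

Fact prod_regular_cst c : cst c \in prod_regular.
Proof.
apply/asboolP; exists [:: (coord_cst X c, 1)]; apply/funext => p.
by rewrite /tensor_fun big_seq1 mulr1.
Qed.

Fact prod_regular_subring : GRing.subring_closed prod_regular.
Proof.
split; first exact: prod_regular_cst.
  move=> _ _ /asboolP[s ->] /asboolP[t ->]; apply/asboolP.
  exists (s ++ [seq (- ab.1, ab.2) | ab <- t]); apply/funext => p.
  rewrite -[LHS]/(tensor_fun s p - tensor_fun t p) /tensor_fun big_cat big_map.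
  by rewrite -sumrN; congr (_ + _); apply: eq_bigr => ab _; rewrite mulNr.
move=> _ _ /asboolP[s ->] /asboolP[t ->]; apply/asboolP.
exists [seq (ab.1 * cd.1, ab.2 * cd.2) | ab <- s, cd <- t]; apply/funext => p.
rewrite -[LHS]/(tensor_fun s p * tensor_fun t p) /tensor_fun big_allpairs_dep.
under [RHS]eq_bigr do under eq_bigr do rewrite mulrACA.
exact: big_distrlr.
Qed.

HB.instance Definition _ := isFunctionSpace.Build k (X * Y)%type
  prod_points_neq0 prod_regular_subring prod_regular_cst.

Fact fst_regular (f : coord_ring X) : f \o (fst : X * Y -> X) \in regular.
Proof.
apply/asboolP; exists [:: (f, 1)]; apply/funext => p.
by rewrite /tensor_fun big_seq1 mulr1.
Qed.
Definition fst_mor := Morphism fst_regular.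

Fact snd_regular (f : coord_ring Y) : f \o (snd : X * Y -> Y) \in regular.
Proof.
apply/asboolP; exists [:: (1, f)]; apply/funext => p.
by rewrite /tensor_fun big_seq1 mul1r.
Qed.
Definition snd_mor := Morphism snd_regular.

Lemma coord_prodE (f : coord_ring (X * Y)%type) : exists s : seq (coord_ring X * coord_ring Y),
  f = \sum_(ab <- s) pullback fst_mor ab.1 * pullback snd_mor ab.2.
Proof.
have /asboolP[s fs] := coord_ringP f; exists s.
by apply/coord_eqP => p; rewrite coord_sumE fs.
Qed.

End ProductSpace.

Section ProductVariety.
Variables X Y : affineVarietyType k.

Fact prod_fingen : exists s : seq (coord_ring (X * Y)%type),
  forall S : {pred coord_ring (X * Y)%type},
    GRing.subalg_closed S -> {subset s <= S} -> forall f, f \in S.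
Proof.
have [[s sP] [t tP]] := (@coord_fingen k X, @coord_fingen k Y).
exists (map (pullback (fst_mor X Y)) s ++ map (pullback (snd_mor X Y)) t).
move=> S Salg sS f; have [S1 Slin SM] := Salg.
have SD : {in S &, forall u v, u + v \in S}.
  by move=> u v uS vS; rewrite -[u]scale1r Slin.
have S0 : 0 \in S by rewrite -[0](addNr 1) -scaleN1r Slin.
have SX (a : coord_ring X) : pullback (fst_mor X Y) a \in S.
  apply: (sP [pred a | pullback (fst_mor X Y) a \in S]).
    split=> [|c u v uS vS|u v uS vS]; rewrite !inE ?rmorph1 ?linearP ?rmorphM //.
      exact: Slin.
    exact: SM.
  by move=> u us; apply: sS; rewrite mem_cat map_f.
have SY (b : coord_ring Y) : pullback (snd_mor X Y) b \in S.
  apply: (tP [pred a | pullback (snd_mor X Y) a \in S]).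
    split=> [|c u v uS vS|u v uS vS]; rewrite !inE ?rmorph1 ?linearP ?rmorphM //.
      exact: Slin.
    exact: SM.
  by move=> u us; apply: sS; rewrite mem_cat map_f ?orbT.
have [r ->] := coord_prodE f.
by elim/big_ind: _ => // ab _; exact: SM.
Qed.

Fact prod_points (chi : {lrmorphism coord_ring (X * Y)%type -> k^o}) :
  exists! p : X * Y, forall f, chi f = f p.
Proof.
pose chiX : {lrmorphism coord_ring X -> k^o} := chi \o pullback (fst_mor X Y).
pose chiY : {lrmorphism coord_ring Y -> k^o} := chi \o pullback (snd_mor X Y).
have [x [xP xU]] := coord_points chiX.
have [y [yP yU]] := coord_points chiY.
exists (x, y); split=> [f|[x' y'] p'].
  have [s ->] := coord_prodE f; rewrite linear_sum coord_sumE.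
  apply: eq_bigr => ab _; rewrite rmorphM coordME.
  by congr (_ * _); [exact: xP|exact: yP].
by congr (_, _); [apply: xU|apply: yU] => f; rewrite /= p'.
Qed.

HB.instance Definition _ := isAffineVariety.Build k (X * Y)%type
  prod_fingen prod_points.
End ProductVariety.
End Product.

Section ZariskiTopology.
Variables (k : fieldType) (X : affineVarietyType k).

Definition zariski_closed (C : set X) : Prop :=
  exists S : set (coord_ring X), C = [set x | forall f, S f -> f x = 0].

Definition zariski_closure (A : set X) : set X :=
  [set x | forall C, zariski_closed C -> A `<=` C -> C x].

Lemma zariski_closure_closed A : zariski_closed (zariski_closure A).
Proof.
exists [set f | forall x, A x -> f x = 0]; apply/seteqP; split=> x.
  move=> Ax f Af; apply: (Ax [set x | f x = 0]); last exact: Af.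
  by exists [set f]; apply/seteqP; split=> y /=; [move=> ? _ ->|apply].
by move=> xP C [S ->] AC f Sf; apply: xP => y /AC; apply.
Qed.

Lemma subset_zariski_closure A : A `<=` zariski_closure A.
Proof. by move=> x Ax C _; apply. Qed.

Record closed_subset := ClosedSubset {
  closed_set :> set X;
  closed_setP : zariski_closed closed_set;
  closed_set_neq0 : closed_set !=set0
}.

(* A nonempty closed subset as an affine variety: its regular functions are  *)
(* the restrictions of those of X.                                           *)
Definition subvariety (C : closed_subset) : Type := {x : X | closed_set C x}.

Section Subvariety.
Variable C : closed_subset.
Local Notation V := (subvariety C).

Definition sub_pt (x : V) : X := sval x.
Lemma sub_ptP (x : V) : closed_set C (sub_pt x). Proof. exact: svalP. Qed.
Lemma sub_pt_inj : injective sub_pt.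
Proof. by move=> x y; apply: eq_sig_hprop => z; exact: Prop_irrelevance. Qed.

Definition sub_regular : {pred V -> k} :=
  [pred f | `[< exists g : coord_ring X, f = g \o sub_pt >]].

Fact sub_points_neq0 : exists _ : V, True.
Proof. by have [x Cx] := closed_set_neq0 C; exists (exist _ x Cx). Qed.

Fact sub_regular_cst c : cst c \in sub_regular.
Proof. by apply/asboolP; exists (coord_cst X c). Qed.

Fact sub_regular_subring : GRing.subring_closed sub_regular.
Proof.
split; first exact: sub_regular_cst.
  by move=> _ _ /asboolP[f ->] /asboolP[g ->]; apply/asboolP; exists (f - g).
by move=> _ _ /asboolP[f ->] /asboolP[g ->]; apply/asboolP; exists (f * g).
Qed.

HB.instance Definition _ := isFunctionSpace.Build k V
  sub_points_neq0 sub_regular_subring sub_regular_cst.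

Fact sub_pt_regular (f : coord_ring X) : f \o sub_pt \in regular.
Proof. by apply/asboolP; exists f. Qed.
Definition sub_incl : variety_morphism V X := Morphism sub_pt_regular.

Lemma pullback_incl_surj (f : coord_ring V) : exists g, f = pullback sub_incl g.
Proof. by have /asboolP[g fg] := coord_ringP f; exists g; apply: val_inj. Qed.

Fact sub_fingen : exists s : seq (coord_ring V), forall S : {pred coord_ring V},
  GRing.subalg_closed S -> {subset s <= S} -> forall f, f \in S.
Proof.
have [s sP] := @coord_fingen k X; exists (map (pullback sub_incl) s).
move=> S [S1 Slin SM] sS f; have [g ->] := pullback_incl_surj f.
apply: (sP [pred g | pullback sub_incl g \in S]).
  split=> [|c u v uS vS|u v uS vS]; rewrite !inE ?rmorph1 ?linearP ?rmorphM //.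
    exact: Slin.
  exact: SM.
by move=> u us; apply: sS; rewrite map_f.
Qed.

Fact sub_points (chi : {lrmorphism coord_ring V -> k^o}) :
  exists! x : V, forall f, chi f = f x.
Proof.
pose chiX : {lrmorphism coord_ring X -> k^o} := chi \o pullback sub_incl.
have [x [xP xU]] := coord_points chiX.
have Cx : closed_set C x.
  have [S CS] := closed_setP C; rewrite CS => f Sf; rewrite -xP /=.
  suff -> : pullback sub_incl f = 0 by rewrite raddf0.
  by apply/coord_eqP => y; have := sub_ptP y; rewrite CS; apply.
exists (exist _ x Cx); split=> [f|y yP].
  by have [g ->] := pullback_incl_surj f; exact: xP.
by apply: sub_pt_inj; apply: xU => f; rewrite /= yP.
Qed.

HB.instance Definition _ := isAffineVariety.Build k V sub_fingen sub_points.

End Subvariety.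
End ZariskiTopology.

Section FunctionField.
Variables (k : fieldType) (X : affineVarietyType k).

Definition irreducible : Prop := forall C D : set X,
  zariski_closed C -> zariski_closed D -> C `|` D = setT -> C = setT \/ D = setT.

Definition coord_domain (_ : irreducible) : Type := coord_ring X.

Variable irrX : irreducible.
Local Notation A := (coord_domain irrX).
HB.instance Definition _ := GRing.ComNzRing.copy A (coord_ring X).

Let is_inv (f g : A) := g * f = 1.
Definition coord_unit : pred A := [pred f | `[< exists g, is_inv f g >]].
Definition coord_inv (f : A) : A :=
  if pselect (exists g, is_inv f g) is left fU then projT1 (cid fU) else f.

Fact coord_mulVf : {in coord_unit, left_inverse 1 coord_inv *%R}.
Proof.
by move=> f /asboolP fU; rewrite /coord_inv; case: pselect => // e; case: cid.
Qed.
Fact coord_unitPl f g : g * f = 1 -> coord_unit f.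
Proof. by move=> gf1; apply/asboolP; exists g. Qed.
Fact coord_inv_out : {in [predC coord_unit], coord_inv =1 id}.
Proof.
move=> f /negP fNU; rewrite /coord_inv; case: pselect => // fU.
by case: fNU; exact/asboolP.
Qed.
HB.instance Definition _ := GRing.ComNzRing_hasMulInverse.Build A
  coord_mulVf coord_unitPl coord_inv_out.

Fact coord_domain_integral : GRing.integral_domain_axiom A.
Proof.
move=> f g fg0; pose Z (h : coord_ring X) : set X := [set x | h x = 0].
have Zcl h : zariski_closed (Z h).
  by exists [set h]; apply/seteqP; split=> x /= => [? _ ->|]; [|apply].
have Z0 h : Z h = setT -> h = 0.
  by move=> ZT; apply/coord_eqP => x; rewrite -[_ = _]/(Z h x) ZT.
case: (irrX (Zcl f) (Zcl g)) => [|/Z0 ->|/Z0 ->]; rewrite ?eqxx ?orbT //.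
apply/seteqP; split=> // x _.
have /eqP : (f : coord_ring X) x * (g : coord_ring X) x = 0.
  by rewrite -coordME [(f : coord_ring X) * _]fg0.
by rewrite mulf_eq0 => /orP[]/eqP; [left|right].
Qed.
HB.instance Definition _ := GRing.ComUnitRing_isIntegral.Build A
  coord_domain_integral.

Definition function_field := {fraction A}.

End FunctionField.
Arguments irreducible {k} X.

Section SeparablyGenerated.
Variables (K : fieldType) (F : {pred K}).

Definition alg_independent n (t : 'I_n -> K) : Prop :=
  forall p : {mpoly K[n]}, p \is a mpolyOver n F -> p.@[t] = 0 -> p = 0.

Definition adjoin n (t : 'I_n -> K) : {pred K} :=
  [pred z | `[< exists p q : {mpoly K[n]},
    [/\ p \is a mpolyOver n F, q \is a mpolyOver n F, q.@[t] != 0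
      & z = p.@[t] / q.@[t]] >]].

Definition separable_algebraic (E : {pred K}) : Prop := forall z : K,
  exists p : {poly K}, [/\ p \is a polyOver E, separable_poly p & root p z].

Definition separably_generated : Prop := exists n (t : 'I_n -> K),
  alg_independent t /\ separable_algebraic (adjoin t).

End SeparablyGenerated.

Section SeparableMorphism.
Variable k : fieldType.

(* The subfield f^* k(W) of k(V), for f dominant. *)
Definition pullback_field (V W : affineVarietyType k) (irrV : irreducible V)
    (f : variety_morphism V W) : {pred function_field irrV} :=
  let phi (a : coord_ring W) : function_field irrV :=
    FracField.tofrac (pullback f a : coord_domain irrV) in
  [pred z | `[< exists a b : coord_ring W, phi b != 0 /\ z = phi a / phi b >]].
Arguments pullback_field {V W} irrV f.

Definition dominant_separable (V W : affineVarietyType k)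
    (irrV : irreducible V) (f : variety_morphism V W) : Prop :=
  separably_generated (pullback_field irrV f).

Definition irreducible_component (V : affineVarietyType k)
    (C : closed_subset V) : Prop :=
  irreducible (subvariety C) /\
  forall D : closed_subset V, irreducible (subvariety D) ->
    closed_set C `<=` closed_set D -> closed_set D `<=` closed_set C.

Section Restriction.
Variables (V W : affineVarietyType k) (f : variety_morphism V W) (C : closed_subset V).

Fact image_closure_neq0 : zariski_closure (f @` closed_set C) !=set0.
Proof.
have [x Cx] := closed_set_neq0 C; exists (f x).
by apply: subset_zariski_closure; exists x.
Qed.
Definition image_closure : closed_subset W :=
  ClosedSubset (@zariski_closure_closed _ _ _) image_closure_neq0.

Fact restr_subproof (x : subvariety C) : closed_set image_closure (f (sub_pt x)).
Proof.
by apply: subset_zariski_closure; exists (sub_pt x) => //; exact: sub_ptP.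
Qed.
Definition restr_fun (x : subvariety C) : subvariety image_closure :=
  exist _ (f (sub_pt x)) (restr_subproof x).

Fact restr_regular (a : coord_ring (subvariety image_closure)) :
  a \o restr_fun \in regular.
Proof.
have [b ->] := pullback_incl_surj a.
by apply/asboolP; exists (pullback f b).
Qed.
Definition restr_mor : variety_morphism (subvariety C) (subvariety image_closure) :=
  Morphism restr_regular.
End Restriction.

(* V and the image of f may be reducible: f is separable when, for each      *)
(* irreducible component C of V, the dominant morphism from C to the closure *)
(* of f(C) is. The function field of this closure is also that of any        *)
(* locally closed irreducible set in which f(C) is dense, so that this does  *)
(* not depend on whether f is seen as a morphism to W or to a locally closed *)
(* subvariety of W containing the image, such as an orbit.                   *)
Definition separable_morphism (V W : affineVarietyType k) (f : variety_morphism V W) :=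
  forall (C : closed_subset V) (irrC : irreducible (subvariety C)),
    irreducible_component C -> dominant_separable irrC (restr_mor f C).

End SeparableMorphism.

Local Open Scope group_scope.
HB.mixin Record isAffineGroup (k : fieldType) G
    of Group G & AffineVariety k G := {
  mulg_regular : forall f : coord_ring G, (fun p : G * G => f (p.1 * p.2)) \in regular;
  invg_regular : forall f : coord_ring G, (fun g : G => f g^-1) \in regular
}.
#[short(type="affineGroupType")]
HB.structure Definition AffineGroup (k : fieldType) :=
  {G of Group G & AffineVariety k G & isAffineGroup k G}.
Local Close Scope group_scope.

Section RationalModules.
Variables (k : fieldType) (G : affineGroupType k) (V : lmodType k).

Definition linear_independent n (e : 'I_n -> V) : Prop :=
  forall c : 'I_n -> k, \sum_i c i *: e i = 0 -> forall i, c i = 0.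

(* Every v lies in a finite-dimensional subspace, with basis e, which G      *)
(* stabilises and on which it acts by matrices with entries in k[G].         *)
Definition rational (act : G -> V -> V) : Prop := forall v, exists n
  (e : 'I_n -> V) (c : 'I_n -> k) (A : 'M[coord_ring G]_n),
  [/\ linear_independent e, v = \sum_i c i *: e i
    & forall g j, act g (e j) = \sum_i A i j g *: e i].

Record rational_module := RationalModule {
  gact :> G -> V -> V;
  gact1 : forall v, gact 1%g v = v;
  gactM : forall g h v, gact (g * h)%g v = gact g (gact h v);
  gact_linear : forall g, linear (gact g);
  gact_rational : rational gact
}.

Definition fixed (act : rational_module) (v : V) : Prop :=
  forall g, act g v = v.

Section Criterion.
Variable act : G -> V -> V.
Hypotheses (act1 : forall v, act 1%g v = v)
  (actM : forall g h v, act (g * h)%g v = act g (act h v))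
  (act_linear : forall g, linear (act g))
  (act_coef : forall v, exists n (b : 'I_n -> V) (a : 'I_n -> coord_ring G),
     forall g, act g v = \sum_i a i g *: b i).

Let actZD g c u v : act g (c *: u + v) = c *: act g u + act g v.
Proof. exact: act_linear. Qed.
Let act0 g : act g 0 = 0.
Proof. by have := actZD g (-1) 0 0; rewrite scaler0 addr0 scaleN1r addNr. Qed.
Let act_sum g I (r : seq I) (c : I -> k) (F : I -> V) :
  act g (\sum_(i <- r) c i *: F i) = \sum_(i <- r) c i *: act g (F i).
Proof. by elim/big_rec2: _ => // i u w _ <-; rewrite actZD. Qed.

Let translate_regular (f : coord_ring G) (h : G) : (fun g => f (g * h)%g) \in regular.
Proof.
have /asboolP[s fs] := mulg_regular f.
suff -> : (fun g => f (g * h)%g) = (\sum_(ab <- s) ab.2 h *: ab.1 : coord_ring G).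
  exact: coord_ringP.
apply/funext => g; have /= -> := congr1 (@^~ (g, h)) fs.
by rewrite coord_sumE /tensor_fun; apply: eq_bigr => ab _; rewrite coordZE mulrC.
Qed.

Lemma rational_criterion : rational act.
Proof.
move=> v.
pose P n := `[< exists (b : 'I_n -> V) (a : 'I_n -> coord_ring G),
  forall g, act g v = \sum_i a i g *: b i >].
have exP : exists n, P n.
  by have [n [b [a ab]]] := act_coef v; exists n; apply/asboolP; exists b, a.
have [n /asboolP[b [a ab]] minn] := ex_minnP exP.
have decr m (b' : 'I_m -> V) (a' : 'I_m -> coord_ring G) :
    (forall g, act g v = \sum_i a' i g *: b' i) -> (n <= m)%N.
  by move=> ab'; apply: minn; apply/asboolP; exists b', a'.
have bfree : linear_independent b.
  move=> c c0 j; case: (eqVneq (c j) 0) => // cj; exfalso.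
  case: n => [|n] in b a ab minn decr c c0 j cj *; first by case: j cj.
  suff /decr : forall g, act g v =
    \sum_i (a (lift j i) - (c (lift j i) / c j) *: a j) g *: b (lift j i).
    by rewrite ltnn.
  move=> g; rewrite ab (bigD1_ord j) //=.
  have -> : b j = - \sum_i (c (lift j i) / c j) *: b (lift j i).
    apply: (scalerI cj); apply/eqP; rewrite scalerN -addr_eq0 scaler_sumr.
    move: c0; rewrite (bigD1_ord j) //= => /eqP.
    by under [X in _ -> _ + X == 0]eq_bigr do rewrite scalerA mulrCA divff // mulr1.
  rewrite scalerN addrC scaler_sumr -sumrB; apply: eq_bigr => i _.
  by rewrite scalerBl scalerA mulrC.
have afree (c : 'I_n -> k) :
    (forall g, \sum_i c i * a i g = 0) -> forall i, c i = 0.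
  move=> c0 j; case: (eqVneq (c j) 0) => // cj; exfalso.
  case: n => [|n] in b a ab minn decr bfree c c0 j cj *; first by case: j cj.
  suff /decr : forall g, act g v =
    \sum_i a (lift j i) g *: (b (lift j i) - (c (lift j i) / c j) *: b j).
    by rewrite ltnn.
  move=> g; rewrite ab (bigD1_ord j) //=.
  have -> : a j g = - \sum_i (c (lift j i) / c j) * a (lift j i) g.
    apply: (mulfI cj); apply/eqP; rewrite mulrN -addr_eq0 mulr_sumr.
    move/eqP: (c0 g); rewrite (bigD1_ord j) //=.
    by under [X in _ -> _ + X == 0]eq_bigr do rewrite mulrA mulrCA divff // mulr1.
  rewrite scaleNr addrC scaler_suml -sumrB; apply: eq_bigr => i _.
  by rewrite scalerBr scalerA mulrC.
pose M (s : seq G) : 'M[k]_(size s, n) := \matrix_(l, i) a i (nth 1%g s l).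
pose Q r := `[< exists s, \rank (M s) = r >].
have exQ : exists r, Q r by exists (\rank (M [::])); apply/asboolP; exists [::].
have leQ r : Q r -> (r <= n)%N by move=> /asboolP[s <-]; exact: rank_leq_col.
have [r /asboolP[s sr] maxr] := ex_maxnP exQ leQ.
have rowM g : (\row_i a i g <= M s)%MS.
  have sub : (M s <= M (g :: s))%MS.
    apply/row_subP => l; have -> : row l (M s) = row (lift ord0 l) (M (g :: s)).
      by apply/rowP => i; rewrite !mxE.
    exact: row_sub.
  have rk : \rank (M (g :: s)) = \rank (M s).
    apply/eqP; rewrite eqn_leq (mxrankS sub) andbT sr.
    by apply: maxr; apply/asboolP; exists (g :: s).
  have -> : \row_i a i g = row ord0 (M (g :: s)).
    by apply/rowP => i; rewrite !mxE.
  apply: (submx_trans (row_sub _ _)).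
  by have := mxrank_leqif_sup sub; rewrite rk => -[_]; rewrite eqxx.
have Mfull : row_full (M s).
  have ker0 : kermx (M s)^T = 0.
    apply/row_matrixP => l; rewrite row0; set w := row l _.
    have Mw : w *m (M s)^T = 0 by rewrite /w -row_mul mulmx_ker row0.
    clearbody w.
    apply/rowP => i; rewrite [RHS]mxE; apply: (afree (fun i => w 0 i)) => g.
    have [D Dg] := submxP (rowM g).
    have : (w *m (\row_i a i g)^T) 0 0 = 0.
      by rewrite Dg trmx_mul mulmxA Mw mul0mx mxE.
    by rewrite mxE => h; rewrite -[RHS]h; apply: eq_bigr => i0 _; rewrite [in RHS]mxE [in RHS]mxE.
  have : row_free (M s)^T by rewrite -kermx_eq0 ker0.
  by rewrite /row_free /row_full mxrank_tr.
have [D DM] := row_fullP Mfull.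
have bE j : b j = \sum_(l < size s) D j l *: act (nth 1%g s l) v.
  under eq_bigr do rewrite ab scaler_sumr.
  rewrite exchange_big /=.
  transitivity (\sum_i (1%:M : 'M[k]_n) j i *: b i).
    rewrite (bigD1 j) //= mxE eqxx scale1r big1 ?addr0 // => i ij.
    by rewrite mxE eq_sym (negPf ij) scale0r.
  apply: eq_bigr => i _; rewrite -DM mxE scaler_suml.
  by apply: eq_bigr => l _; rewrite scalerA mxE.
exists n, b, (fun i => a i 1%g), (\matrix_(i, j)
  \sum_(l < size s) D j l *: Coord (translate_regular (a i) (nth 1%g s l))).
split=> // [|g j]; first by rewrite -ab act1.
rewrite {1}bE act_sum.
under eq_bigr do rewrite -actM ab scaler_sumr.
rewrite exchange_big; apply: eq_bigr => i _ /=.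
rewrite mxE coord_sumE scaler_suml; apply: eq_bigr => l _.
by rewrite scalerA.
Qed.

End Criterion.

Lemma rational_coef (act : rational_module) v :
  exists n (b : 'I_n -> V) (a : 'I_n -> coord_ring G),
     forall g, act g v = \sum_i a i g *: b i.
Proof.
have [n [e [c [A [_ -> Ae]]]]] := gact_rational act v.
exists n, e, (fun i => \sum_j c j *: A i j) => g.
have lin m (F : 'I_m -> V) (d : 'I_m -> k) :
    act g (\sum_i d i *: F i) = \sum_i d i *: act g (F i).
  have act0 : act g 0 = 0.
    by have := gact_linear act g (-1) 0 0; rewrite scaler0 addr0 scaleN1r addNr.
  by elim/big_rec2: _ => // i u w _ <-; rewrite gact_linear.
rewrite lin; under eq_bigr do rewrite Ae scaler_sumr.
rewrite exchange_big; apply: eq_bigr => i _ /=.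
rewrite coord_sumE scaler_suml; apply: eq_bigr => j _.
by rewrite scalerA.
Qed.

End RationalModules.

Section RestrictScalars.
Variables (k : fieldType) (R : algType k) (M : lmodType R).

Definition restrict_scalars : Type := M.
HB.instance Definition _ := GRing.Zmodule.copy restrict_scalars M.

Definition restr_scale (c : k) (m : restrict_scalars) : restrict_scalars :=
  c%:A *: (m : M).
Fact restr_scaleA a b m : restr_scale a (restr_scale b m) = restr_scale (a * b) m.
Proof. by rewrite /restr_scale scalerA -scalerAl mul1r scalerA. Qed.
Fact restr_scale1 : left_id 1 restr_scale.
Proof. by move=> m; rewrite /restr_scale !scale1r. Qed.
Fact restr_scaleDr : right_distributive restr_scale +%R.
Proof. by move=> c m n; apply: scalerDr. Qed.
Fact restr_scaleDl m : {morph restr_scale^~ m : a b / a + b}.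
Proof. by move=> a b; rewrite /restr_scale !scalerDl. Qed.
HB.instance Definition _ := GRing.Zmodule_isLmodule.Build k restrict_scalars
  restr_scaleA restr_scale1 restr_scaleDr restr_scaleDl.

Lemma restr_scaleE c (m : restrict_scalars) : c *: m = c%:A *: (m : M).
Proof. by []. Qed.

End RestrictScalars.

Section GRModules.
Variables (k : fieldType) (G : affineGroupType k) (R : comAlgType k).

Record module_algebra := ModuleAlgebra {
  ma_module :> rational_module G R;
  ma_monoid : forall g, monoid_morphism (ma_module g)
}.

Variable a : module_algebra.

(* A (G,R)-module; its k-structure is the one induced by k -> R. *)
Record grmodule := GRModule {
  grm_sort :> lmodType R;
  grm_act : rational_module G (restrict_scalars grm_sort);
  grm_actZ : forall g (r : R) (m : grm_sort),
    grm_act g (r *: m) = a g r *: (grm_act g m : grm_sort)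
}.

Definition grm_fixed (M : grmodule) (m : M) : Prop := fixed (grm_act M) m.

Record grmorphism (M N : grmodule) := GRMorphism {
  grm_fun :> {linear M -> N};
  grm_equivariant : forall g m, grm_fun (grm_act M g m) = grm_act N g (grm_fun m)
}.

Record stable_ideal := StableIdeal {
  ideal_set :> zmodClosed R;
  ideal_mulr : forall r x, x \in ideal_set -> r * x \in ideal_set;
  ideal_stable : forall g x, x \in ideal_set -> a g x \in ideal_set
}.

Section Quotient.
Variable J : stable_ideal.

Definition quotient_alg : Type := Quotient.quot J.
HB.instance Definition _ := GRing.Zmodule.on quotient_alg.
Definition quotient_pi : R -> quotient_alg := \pi_(Quotient.quot J)%qT.

Fact quotient_pi_is_zmod_morphism : zmod_morphism quotient_pi.
Proof. exact: (raddfB \pi_(Quotient.quot J)%qT). Qed.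
HB.instance Definition _ := GRing.isZmodMorphism.Build R quotient_alg
  quotient_pi quotient_pi_is_zmod_morphism.

Lemma quotient_pi_eq x y : (quotient_pi x = quotient_pi y) <-> (x - y \in J).
Proof.
by rewrite Quotient.idealrBE; split=> xy; apply/eqP.
Qed.
Lemma quotient_piK : cancel (@repr _ (Quotient.quot J)) quotient_pi.
Proof. exact: reprK. Qed.
Lemma quotient_pi_surj q : exists x, q = quotient_pi x.
Proof. by exists (repr q); rewrite quotient_piK. Qed.

Definition quotient_scale (r : R) (q : quotient_alg) : quotient_alg :=
  quotient_pi (r * repr q).
Lemma quotient_scale_pi r x :
  quotient_scale r (quotient_pi x) = quotient_pi (r * x).
Proof.
apply/quotient_pi_eq; rewrite -mulrBr ideal_mulr //.
by apply/quotient_pi_eq; rewrite quotient_piK.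
Qed.

Fact quotient_scaleA r s q :
  quotient_scale r (quotient_scale s q) = quotient_scale (r * s) q.
Proof. by have [x ->] := quotient_pi_surj q; rewrite !quotient_scale_pi mulrA. Qed.
Fact quotient_scale1 : left_id 1 quotient_scale.
Proof.
by move=> q; have [x ->] := quotient_pi_surj q; rewrite quotient_scale_pi mul1r.
Qed.
Fact quotient_scaleDr : right_distributive quotient_scale +%R.
Proof.
move=> r p q; have [[x ->] [y ->]] := (quotient_pi_surj p, quotient_pi_surj q).
by rewrite -raddfD !quotient_scale_pi mulrDr raddfD.
Qed.
Fact quotient_scaleDl q : {morph quotient_scale^~ q : r s / r + s}.
Proof.
move=> r s; have [x ->] := quotient_pi_surj q.
by rewrite !quotient_scale_pi mulrDl raddfD.
Qed.
HB.instance Definition _ := GRing.Zmodule_isLmodule.Build R quotient_alg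
  quotient_scaleA quotient_scale1 quotient_scaleDr quotient_scaleDl.

Fact quotient_pi_scalable : scalable (quotient_pi : R^o -> quotient_alg).
Proof. by move=> r x; rewrite -quotient_scale_pi. Qed.

Local Notation V := (restrict_scalars quotient_alg).
Lemma quotient_piZ (c : k) x : quotient_pi (c *: x) = c *: (quotient_pi x : V).
Proof. by rewrite restr_scaleE -quotient_pi_scalable -[c *: x]mulr_algl. Qed.

Definition quotient_act (g : G) (q : V) : V := quotient_pi (a g (repr q)).
Lemma quotient_act_pi g x : quotient_act g (quotient_pi x) = quotient_pi (a g x).
Proof.
have aB u v : a g u - a g v = a g (u - v).
  by rewrite addrC -scaleN1r -gact_linear addrC scaleN1r.
apply/quotient_pi_eq; rewrite aB ideal_stable //.
by apply/quotient_pi_eq; rewrite quotient_piK.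
Qed.

Fact quotient_act1 q : quotient_act 1%g q = q.
Proof. by have [x ->] := quotient_pi_surj q; rewrite quotient_act_pi gact1. Qed.
Fact quotient_actM g h q :
  quotient_act (g * h)%g q = quotient_act g (quotient_act h q).
Proof.
by have [x ->] := quotient_pi_surj q; rewrite !quotient_act_pi gactM.
Qed.
Fact quotient_act_linear g : linear (quotient_act g).
Proof.
move=> c p q; have [[x ->] [y ->]] := (quotient_pi_surj p, quotient_pi_surj q).
transitivity (quotient_act g (quotient_pi (c *: x + y))).
  by congr quotient_act; rewrite raddfD -quotient_piZ.
by rewrite !quotient_act_pi gact_linear raddfD -quotient_piZ.
Qed.
Fact quotient_act_rational : rational quotient_act.
Proof.
apply: rational_criterion quotient_act1 quotient_actM quotient_act_linear _ => q.
have [x ->] := quotient_pi_surj q; have [n [b [c bc]]] := rational_coef a x.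
exists n, (fun i => quotient_pi (b i)), c => g.
rewrite quotient_act_pi bc raddf_sum.
by apply: eq_bigr => i _; exact: quotient_piZ.
Qed.
Definition quotient_module := RationalModule
  quotient_act1 quotient_actM quotient_act_linear quotient_act_rational.

Fact quotient_actZ g (r : R) (q : quotient_alg) :
  quotient_module g (r *: q) = a g r *: (quotient_module g q : quotient_alg).
Proof.
have [x ->] := quotient_pi_surj q.
by rewrite -quotient_pi_scalable /= !quotient_act_pi (ma_monoid a g).2
  quotient_pi_scalable.
Qed.

(* R/J *)
Definition quotient_grmodule : grmodule := GRModule quotient_actZ.
End Quotient.

Definition linearly_reductive : Prop :=
  forall (M : grmodule) (J : stable_ideal)
    (lambda : grmorphism M (quotient_grmodule J)),
  (forall q, exists m, lambda m = q) ->
  exists m, grm_fixed m /\ lambda m = quotient_pi J 1.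

Definition unipotent : Prop := forall M : grmodule,
  (exists m : M, m <> 0) -> exists m : M, m <> 0 /\ grm_fixed m.

End GRModules.

Section Actions.
Variables (k : fieldType) (G : affineGroupType k) (X : affineVarietyType k).

Record right_action := RightAction {
  ract :> X -> G -> X;
  ract1 : forall x, ract x 1%g = x;
  ractM : forall x g h, ract x (g * h)%g = ract (ract x g) h;
  ract_regular :
    forall f : coord_ring X, (fun p : X * G => f (ract p.1 p.2)) \in regular
}.

Variable act : right_action.

Fact translate_regular g (f : coord_ring X) : (fun x => f (act x g)) \in regular.
Proof.
have /asboolP[s fs] := ract_regular act f.
suff -> : (fun x => f (act x g)) = (\sum_(ab <- s) ab.2 g *: ab.1 : coord_ring X).
  exact: coord_ringP.
apply/funext => x; have /= -> := congr1 (@^~ (x, g)) fs.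
by rewrite coord_sumE /tensor_fun; apply: eq_bigr => ab _; rewrite coordZE mulrC.
Qed.
Definition translate (g : G) (f : coord_ring X) : coord_ring X :=
  Coord (translate_regular g f).

Fact translate1 f : translate 1%g f = f.
Proof. by apply/coord_eqP => x; rewrite /= ract1. Qed.
Fact translateM g h f : translate (g * h)%g f = translate g (translate h f).
Proof. by apply/coord_eqP => x; rewrite /= ractM. Qed.
Fact translate_linear g : linear (translate g).
Proof. by move=> c f1 f2; apply/coord_eqP. Qed.
Fact translate_rational : rational translate.
Proof.
apply: rational_criterion translate1 translateM translate_linear _ => f.
have /asboolP[s fs] := ract_regular act f.
exists (size s), (fun i => (nth (0, 0) s i).1), (fun i => (nth (0, 0) s i).2) => g.
apply/coord_eqP => x; have /= -> := congr1 (@^~ (x, g)) fs.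
rewrite coord_sumE /tensor_fun (big_nth (0, 0)) big_mkord.
by apply: eq_bigr => i _; rewrite coordZE mulrC.
Qed.
Fact translate_monoid g : monoid_morphism (translate g).
Proof. by split=> [|f1 f2]; apply/coord_eqP. Qed.

Definition coord_module_algebra : module_algebra G (coord_ring X) :=
  ModuleAlgebra (ma_module := RationalModule
    translate1 translateM translate_linear translate_rational) translate_monoid.

Definition linearly_reductive_action := linearly_reductive coord_module_algebra.
Definition unipotent_action := unipotent coord_module_algebra.

Fact orbit_regular x (f : coord_ring X) : f \o act x \in regular.
Proof.
have /asboolP[s fs] := ract_regular act f.
suff -> : f \o act x = (\sum_(ab <- s) ab.1 x *: ab.2 : coord_ring G).
  exact: coord_ringP.
apply/funext => g; have /= -> := congr1 (@^~ (x, g)) fs.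
by rewrite coord_sumE /tensor_fun; apply: eq_bigr => ab _; rewrite coordZE.
Qed.
Definition orbit_mor (x : X) : variety_morphism G X := Morphism (orbit_regular x).

Definition separable_action : Prop := forall x, separable_morphism (orbit_mor x).

Definition ract_orbit (x : X) : set X := range (act x).

Fact orbit_neq0 x : ract_orbit x !=set0.
Proof. by exists (act x 1%g); exists 1%g. Qed.

Definition orbit_subset x (clo : zariski_closed (ract_orbit x)) : closed_subset X :=
  ClosedSubset clo (orbit_neq0 x).

End Actions.

(* Main.v *)
(* Let R = k[X]. Linear reductivity makes the functor of fixed elements on    *)
(* (G,R)-modules right exact, and unipotence makes it faithful; hence every   *)
(* (G,R)-module M is generated over R by its fixed elements, because the      *)
(* quotient of M by the submodule S that they generate has no nonzero fixed   *)
(* element. Take M = k[G], with R acting through the comorphism R -> k[G] of  *)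
(* the orbit map g |-> x g. Its fixed elements are the constants, so that the *)
(* comorphism is surjective, i.e. the orbit map is a closed embedding.        *)
Require Import Defs.
From HB Require Import structures.
From mathcomp Require Import all_boot all_algebra.
From mathcomp Require Import boolp classical_sets functions.

Set Implicit Arguments.
Unset Strict Implicit.
Unset Printing Implicit Defensive.

Import GRing.Theory.
Local Open Scope ring_scope.
Local Open Scope quotient_scope.
Local Open Scope classical_set_scope.

(** Everything rests on the surjectivity of the comorphism pi : k[X] -> k[G] of g |-> x g
    ([comorphism_surj]). Let S be a stable submodule of a (G,R)-module M that contains all fixed
    elements. A fixed class n in M / S spans a copy of R / J, with J its annihilator; linear
    reductivity lifts 1 + J to a fixed element of M, which lies in S, so that n = 0
    ([fixed_modulo]). Unipotence then forces M / S = 0 ([generated_by_fixed]). For M = k[G] this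
    applies to the image of pi, as the fixed functions are constants. Once pi is surjective, a point
    where its kernel vanishes is a character of k[G], hence lies on the orbit ([orbit_closed]), and
    the inverse of the orbit map is regular ([orbit_map_iso]). *)

(** * Submodules and quotients of (G,R)-modules *)

(** Among the matrices with rows in U take one of maximal rank: adding a row u of U cannot raise the
    rank, so u is already in the row space. This serves to show that submodules are rational. *)
Lemma subspace_rowspace (k : fieldType) n (U : 'rV[k]_n -> Prop) :
    U 0 -> (forall c u v, U u -> U v -> U (c *: u + v)) ->
  exists m (D : 'M[k]_(m, n)),
    (forall l, U (row l D)) /\ (forall u, U u -> (u <= D)%MS).
Proof.
move=> U0 Ulin.
pose Q (r : nat) := `[< exists m (D : 'M[k]_(m, n)),
  (forall l, U (row l D)) /\ \rank D = r >].
have exQ : exists r, Q r.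
  exists 0%N; apply/asboolP; exists 0%N, 0; split; last exact: mxrank0.
  by case.
have leQ r : Q r -> (r <= n)%N.
  by move=> /asboolP[m [D [_ <-]]]; exact: rank_leq_col.
have [r /asboolP[m [D [UD rD]]] maxr] := ex_maxnP exQ leQ.
exists m, D; split=> // u Uu.
have subD : (D <= col_mx u D)%MS by rewrite -addsmxE addsmxSr.
have : (col_mx u D <= D)%MS.
  rewrite -(geq_leqif (mxrank_leqif_sup subD)) rD.
  apply: maxr; apply/asboolP; exists (1 + m)%N, (col_mx u D); split=> // l.
  rewrite -[l]fintype.splitK; case: (fintype.split l) => j /=.
    by rewrite rowKu (ord1 j) row_id.
  by rewrite rowKd.
by apply: submx_trans; rewrite -addsmxE addsmxSl.
Qed.

Section Submodules.
Variables (k : fieldType) (G : affineGroupType k) (R : comAlgType k).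
Variables (a : module_algebra G R) (M : grmodule a).

Lemma grm_act_subr g (m n : M) : grm_act M g (m - n) = grm_act M g m - grm_act M g n :> M.
Proof.
rewrite addrC [RHS]addrC -!scaleN1r.
have := gact_linear (grm_act M) g (-1) n m.
by rewrite !restr_scaleE scaleN1r.
Qed.

Record stable_submodule := StableSubmodule {
  submodule_set :> {pred M};
  submodule_closed : GRing.submod_closed submodule_set;
  submodule_stable : forall g m, m \in submodule_set ->
    (grm_act M g m : M) \in submodule_set
}.

HB.instance Definition _ (S : stable_submodule) :=
  GRing.isSubmodClosed.Build R M (submodule_set S) (submodule_closed S).

Variable S : stable_submodule.

Definition sub_module : Type := {m : M | m \in S}.
HB.instance Definition _ := [isSub of sub_module for @sval M _].
HB.instance Definition _ := [Choice of sub_module by <:].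
HB.instance Definition _ := [SubChoice_isSubLmodule of sub_module by <:].

Local Notation P := (restrict_scalars sub_module).

Definition sub_act (g : G) (m : P) : P :=
  Sub (grm_act M g (val m)) (submodule_stable g (valP m)).

Fact sub_act1 m : sub_act 1%g m = m.
Proof. by apply: val_inj; rewrite /= gact1. Qed.
Fact sub_actM g h m : sub_act (g * h)%g m = sub_act g (sub_act h m).
Proof. by apply: val_inj; rewrite /= gactM. Qed.
Fact sub_act_linear g : linear (sub_act g).
Proof.
by move=> c m n; apply: val_inj; rewrite /= -[RHS](gact_linear (grm_act M)).
Qed.
(* A linear combination of the b_i that lies in S is a combination of those   *)
(* whose coefficient rows are the rows of D, with coefficients given by       *)
(* [pinvmx D].                                                                *)
Fact sub_act_rational : rational sub_act.
Proof.
apply: rational_criterion sub_act1 sub_actM sub_act_linear _ => v.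
have [n [b [c vE]]] := rational_coef (grm_act M) (val v).
pose lc (w : 'rV[k]_n) : restrict_scalars M := \sum_i w 0 i *: b i.
have lcP c0 u w : lc (c0 *: u + w) = c0 *: lc u + lc w.
  rewrite /lc scaler_sumr -big_split; apply: eq_bigr => i _ /=.
  by rewrite !mxE scalerDl scalerA.
have [||m [D [UD Ule]]] :=
    @subspace_rowspace k n (fun w => (lc w : M) \in S).
- by rewrite /lc big1 ?rpred0 // => i _; rewrite mxE scale0r.
- by move=> c0 u w uS wS; rewrite lcP restr_scaleE rpredD ?rpredZ.
exists m, (fun l => Sub (lc (row l D)) (UD l) : P),
  (fun l => \sum_i (pinvmx D) i l *: c i) => g.
apply: val_inj; rewrite raddf_sum /= vE.
pose w : 'rV[k]_n := \row_i c i g.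
have lcw : lc w = \sum_i c i g *: b i by apply: eq_bigr => i _; rewrite mxE.
(* [lc w] is the image of v under g, which lies in S by stability. *)
have wD : (w <= D)%MS.
  by apply: Ule; rewrite lcw -vE; apply: submodule_stable; exact: valP.
rewrite -lcw -[w](mulmxKpV wD).
transitivity (\sum_l (w *m pinvmx D) 0 l *: lc (row l D)).
  rewrite /lc; under [RHS]eq_bigr do rewrite scaler_sumr.
  rewrite exchange_big; apply: eq_bigr => i _ /=.
  rewrite mxE scaler_suml; apply: eq_bigr => l _.
  by rewrite scalerA [row _ _ _ _]mxE.
apply: eq_bigr => l _; rewrite [in RHS]coord_sumE -restr_scaleE [(_ *m _) _ _]mxE.
by congr (_%:A *: _); apply: eq_bigr => i _; rewrite mxE mulrC coordZE.
Qed.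
Definition sub_rational_module := RationalModule
  sub_act1 sub_actM sub_act_linear sub_act_rational.
Fact sub_actZ g (r : R) (m : sub_module) :
  sub_rational_module g (r *: m) = a g r *: (sub_rational_module g m : sub_module).
Proof. by apply: val_inj; rewrite /= grm_actZ. Qed.
Definition sub_grmodule : grmodule a := GRModule sub_actZ.

Definition quot_module : Type := Quotient.quot (submodule_set S).
HB.instance Definition _ := GRing.Zmodule.on quot_module.
Definition quot_pi : M -> quot_module := \pi_(Quotient.quot (submodule_set S)).

Fact quot_pi_is_zmod_morphism : zmod_morphism quot_pi.
Proof. exact: (raddfB \pi_(Quotient.quot (submodule_set S))). Qed.
HB.instance Definition _ := GRing.isZmodMorphism.Build M quot_module
  quot_pi quot_pi_is_zmod_morphism.

Lemma quot_pi_eq m n : (quot_pi m = quot_pi n) <-> (m - n \in S).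
Proof. by rewrite Quotient.idealrBE; split=> mn; apply/eqP. Qed.
Lemma quot_piK : cancel (@repr _ (Quotient.quot (submodule_set S))) quot_pi.
Proof. exact: reprK. Qed.
Lemma quot_pi_surj q : exists m, q = quot_pi m.
Proof. by exists (repr q); rewrite quot_piK. Qed.

Definition quot_scale (r : R) (q : quot_module) : quot_module :=
  quot_pi (r *: (repr q : M)).
Lemma quot_scale_pi r m : quot_scale r (quot_pi m) = quot_pi (r *: m).
Proof.
apply/quot_pi_eq; rewrite -scalerBr rpredZ //.
by apply/quot_pi_eq; rewrite quot_piK.
Qed.

Fact quot_scaleA r s q : quot_scale r (quot_scale s q) = quot_scale (r * s) q.
Proof. by have [m ->] := quot_pi_surj q; rewrite !quot_scale_pi scalerA. Qed.
Fact quot_scale1 : left_id 1 quot_scale.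
Proof. by move=> q; have [m ->] := quot_pi_surj q; rewrite quot_scale_pi scale1r. Qed.
Fact quot_scaleDr : right_distributive quot_scale +%R.
Proof.
move=> r p q; have [[m ->] [n ->]] := (quot_pi_surj p, quot_pi_surj q).
by rewrite -raddfD !quot_scale_pi scalerDr raddfD.
Qed.
Fact quot_scaleDl q : {morph quot_scale^~ q : r s / r + s}.
Proof.
move=> r s; have [m ->] := quot_pi_surj q.
by rewrite !quot_scale_pi scalerDl raddfD.
Qed.
HB.instance Definition _ := GRing.Zmodule_isLmodule.Build R quot_module
  quot_scaleA quot_scale1 quot_scaleDr quot_scaleDl.

Fact quot_pi_scalable : scalable quot_pi.
Proof. by move=> r m; rewrite -quot_scale_pi. Qed.
HB.instance Definition _ := GRing.isScalable.Build R M quot_module *:%R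
  quot_pi quot_pi_scalable.

Local Notation Q := (restrict_scalars quot_module).
Definition quot_act (g : G) (q : Q) : Q := quot_pi (grm_act M g (repr q)).
Lemma quot_act_pi g m : quot_act g (quot_pi m) = quot_pi (grm_act M g m).
Proof.
apply/quot_pi_eq; rewrite -grm_act_subr submodule_stable //.
by apply/quot_pi_eq; rewrite quot_piK.
Qed.

Fact quot_act1 q : quot_act 1%g q = q.
Proof. by have [m ->] := quot_pi_surj q; rewrite quot_act_pi gact1. Qed.
Fact quot_actM g h q : quot_act (g * h)%g q = quot_act g (quot_act h q).
Proof. by have [m ->] := quot_pi_surj q; rewrite !quot_act_pi gactM. Qed.
Fact quot_act_linear g : linear (quot_act g).
Proof.
move=> c p q; have [[m ->] [n ->]] := (quot_pi_surj p, quot_pi_surj q).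
rewrite !restr_scaleE -[X in quot_act g X](linearP quot_pi) !quot_act_pi.
by rewrite -[RHS](linearP quot_pi) -(gact_linear (grm_act M)).
Qed.
Fact quot_act_rational : rational quot_act.
Proof.
apply: rational_criterion quot_act1 quot_actM quot_act_linear _ => q.
have [m ->] := quot_pi_surj q; have [n [b [c bc]]] := rational_coef (grm_act M) m.
exists n, (fun i => quot_pi (b i)), c => g.
rewrite quot_act_pi bc raddf_sum.
by apply: eq_bigr => i _; exact: quot_pi_scalable.
Qed.
Definition quot_rational_module := RationalModule
  quot_act1 quot_actM quot_act_linear quot_act_rational.
Fact quot_actZ g (r : R) (q : quot_module) :
  quot_rational_module g (r *: q)
  = a g r *: (quot_rational_module g q : quot_module).
Proof.
have [m ->] := quot_pi_surj q.
by rewrite -linearZ /= !quot_act_pi grm_actZ linearZ.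
Qed.
Definition quot_grmodule : grmodule a := GRModule quot_actZ.

End Submodules.

(** * Modules generated by their fixed elements *)

Section GeneratedByFixed.
Variables (k : fieldType) (G : affineGroupType k) (R : comAlgType k).
Variable a : module_algebra G R.
Hypotheses (uni : unipotent a) (red : linearly_reductive a).
Variables (M : grmodule a) (S : stable_submodule M).
Hypothesis fixS : forall m : M, grm_fixed m -> m \in S.

Section FixedModulo.
Variable n : M.
Hypothesis nfix : forall g, (grm_act M g n : M) - n \in S.

(* The kernel of R -> M / S, r |-> r n. *)
Definition ann_pred : {pred R} := [pred r | r *: n \in S].
Fact ann_zmod_closed : GRing.zmod_closed ann_pred.
Proof.
split=> [|r s]; rewrite !inE ?scale0r ?rpred0 // => rn sn.
by rewrite scalerBl rpredB.
Qed.
HB.instance Definition _ := GRing.isZmodClosed.Build R ann_pred ann_zmod_closed.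
Fact ann_mulr r x : x \in ann_pred -> r * x \in ann_pred.
Proof. by rewrite !inE -scalerA => /rpredZ. Qed.

(** Acting by g on m = r n modulo S gives g m = (g r)(g n), and g n = n modulo S. The stability of
    [ann_pred] and [line_pred] and the equivariance of [line_coef] all come from this. *)
Lemma act_scale_mod g (r : R) (m : M) : m - r *: n \in S ->
  (grm_act M g m : M) - a g r *: n \in S.
Proof.
move=> /(submodule_stable g); rewrite grm_act_subr grm_actZ => mS.
rewrite -(subrK (a g r *: (grm_act M g n : M)) (grm_act M g m : M)) -addrA.
by rewrite -scalerBr rpredD ?rpredZ.
Qed.

Fact ann_stable g x : x \in ann_pred -> a g x \in ann_pred.
Proof.
(* That x n lies in S means that 0 = x n modulo S, whence the choice m = 0. *)
rewrite !inE => xn; have := @act_scale_mod g x 0.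
rewrite sub0r rpredN => /(_ xn).
by rewrite -[X in grm_act M g X](subrr 0) grm_act_subr subrr sub0r rpredN.
Qed.
Definition ann_ideal : stable_ideal a := StableIdeal ann_mulr ann_stable.

(* The preimage in M of the submodule R n of M / S. *)
Definition line_pred : {pred M} :=
  [pred m | `[< exists r : R, m - r *: n \in S >]].
Fact line_submod_closed : GRing.submod_closed line_pred.
Proof.
split; first by apply/asboolP; exists 0; rewrite scale0r subr0 rpred0.
move=> c u v /asboolP[r ru] /asboolP[s sv]; apply/asboolP; exists (c * r + s).
by rewrite scalerDl -scalerA opprD addrACA -scalerBr rpredD ?rpredZ.
Qed.
Fact line_stable g m : m \in line_pred -> (grm_act M g m : M) \in line_pred.
Proof.
by move=> /asboolP[r mr]; apply/asboolP; exists (a g r); exact: act_scale_mod.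
Qed.
Definition line_submodule : stable_submodule M := StableSubmodule line_submod_closed line_stable.

Local Notation P := (sub_grmodule line_submodule).
(** The projection of R n + S onto its image in M / S, followed by the inverse of the isomorphism
    induced by r |-> r n. The chosen coefficient is unique only modulo [ann_ideal]; [line_coefP]
    shows that the choice does not matter. *)
Definition line_coef (m : P) : quotient_grmodule ann_ideal :=
  quotient_pi ann_ideal (projT1 (cid (asboolW (valP m)))).
Lemma line_coefP (m : P) r :
  (val m : M) - r *: n \in S -> line_coef m = quotient_pi ann_ideal r.
Proof.
rewrite /line_coef; case: cid => s /= ms mr; apply/quotient_pi_eq.
rewrite [_ \in _]inE scalerBl.
have -> : s *: n - r *: n = ((val m : M) - r *: n) - ((val m : M) - s *: n).
  by rewrite opprB [RHS]addrC addrA subrK.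
exact: rpredB.
Qed.
Lemma line_coef_ex (m : P) : exists r, (val m : M) - r *: n \in S.
Proof. exact: (asboolW (valP m)). Qed.

Fact line_coef_linear : linear line_coef.
Proof.
move=> c u v; have [[r ur] [s vs]] := (line_coef_ex u, line_coef_ex v).
rewrite (line_coefP ur) (line_coefP vs) -(quotient_pi_scalable ann_ideal) -raddfD.
apply: line_coefP; rewrite linearP /=.
by rewrite scalerDl -scalerA opprD addrACA -scalerBr rpredD ?rpredZ.
Qed.
HB.instance Definition _ := GRing.isLinear.Build R P (quotient_grmodule ann_ideal)
  *:%R line_coef line_coef_linear.
Fact line_coef_equivariant g m :
  line_coef (grm_act P g m) = grm_act (quotient_grmodule ann_ideal) g (line_coef m).
Proof.
have [r mr] := line_coef_ex m; rewrite (line_coefP mr) /= quotient_act_pi.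
by apply: line_coefP; exact: act_scale_mod.
Qed.

(* R n in M / S is R / ann_ideal, so the class of 1 lifts to a fixed m in M,  *)
(* which lies in S and has the same class as n modulo S.                      *)
Lemma fixed_modulo : n \in S.
Proof.
have [|m [mfix m1]] := @red _ _ (GRMorphism line_coef_equivariant).
- move=> q; have [r ->] := quotient_pi_surj q.
  have rn : r *: n \in line_submodule.
    by apply/asboolP; exists r; rewrite subrr rpred0.
  by exists (Sub (r *: n) rn); apply: line_coefP; rewrite /= subrr rpred0.
(* Modulo S, r n equals both m, which is 0 there, and n, since r - 1 lies in [ann_ideal]. *)
have [r mr] := line_coef_ex m.
move: m1; rewrite /= (line_coefP mr) => /quotient_pi_eq; rewrite inE scalerBl scale1r.
have mS : val m \in S.
  by apply: fixS => g; rewrite -[in RHS](mfix g).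
have rS : r *: n \in S by move: mr; rewrite rpredBl.
by rewrite rpredBl.
Qed.
End FixedModulo.

(** Otherwise M / S is nonzero and by unipotence has a nonzero fixed class, whose representatives
    lie in S by [fixed_modulo]. *)
Lemma generated_by_fixed m : m \in S.
Proof.
apply: contrapT => /negP mS.
have [|q [q0 qfix]] := @uni (quot_grmodule S).
  exists (quot_pi S m); rewrite -(raddf0 (quot_pi S)) => /quot_pi_eq.
  by rewrite subr0 => /idP; exact/negP.
apply: q0; have [n qn] := quot_pi_surj q; move: qfix; rewrite qn => qfix.
rewrite -(raddf0 (quot_pi S)); apply/quot_pi_eq; rewrite subr0.
apply: fixed_modulo => g; apply/quot_pi_eq.
by rewrite -quot_act_pi; exact: qfix.
Qed.

End GeneratedByFixed.

(** * The (G,k[X])-module k[G] and surjectivity of the comorphism *)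

Section OrbitModule.
Variables (k : fieldType) (G : affineGroupType k) (X : affineVarietyType k).
Variables (act : right_action G X) (x : X).

(* k[G] with k[X] acting through the comorphism of g |-> x g. *)
Definition orbit_module : Type := coord_ring G.
HB.instance Definition _ := GRing.Zmodule.on orbit_module.
Local Notation pi := (pullback (orbit_mor act x)).

Definition orbit_scale (r : coord_ring X) (f : orbit_module) : orbit_module :=
  pi r * (f : coord_ring G).
Fact orbit_scaleA r s f : orbit_scale r (orbit_scale s f) = orbit_scale (r * s) f.
Proof. by rewrite /orbit_scale rmorphM mulrA. Qed.
Fact orbit_scale1 : left_id 1 orbit_scale.
Proof. by move=> f; rewrite /orbit_scale rmorph1 mul1r. Qed.
Fact orbit_scaleDr : right_distributive orbit_scale +%R.
Proof. by move=> r f g; exact: mulrDr. Qed.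
Fact orbit_scaleDl f : {morph orbit_scale^~ f : r s / r + s}.
Proof. by move=> r s; rewrite /orbit_scale rmorphD mulrDl. Qed.
HB.instance Definition _ := GRing.Zmodule_isLmodule.Build (coord_ring X) orbit_module
  orbit_scaleA orbit_scale1 orbit_scaleDr orbit_scaleDl.

Lemma orbit_scaleE (r : coord_ring X) (f : orbit_module) g :
  coord_fun (r *: f) g = r (act x g) * coord_fun f g.
Proof. by []. Qed.

Local Notation V := (restrict_scalars orbit_module).

(** The comorphism preserves constants, so the k-structure induced through k[X] is the usual one on
    k[G]. *)
Lemma orbit_restr_scaleE (c : k) (f : V) g : coord_fun (c *: f) g = c * coord_fun f g.
Proof. by rewrite restr_scaleE orbit_scaleE coordZE mulr1. Qed.

(** Seeing G as a variety on which it acts itself makes [translate], with its rationality, available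
    on k[G]. *)
Definition mulg_action : right_action G G :=
  RightAction (@mulg1 G) (@mulgA G) (@mulg_regular k G).

Definition right_translate (g : G) (f : V) : V := translate mulg_action g f.
Fact right_translate1 f : right_translate 1%g f = f.
Proof. exact: translate1. Qed.
Fact right_translateM g h f :
  right_translate (g * h)%g f = right_translate g (right_translate h f).
Proof. exact: translateM. Qed.
Fact right_translate_linear g : linear (right_translate g).
Proof.
move=> c u v; apply/coord_eqP => h; rewrite [RHS]coordDE orbit_restr_scaleE.
by rewrite -[LHS]/(coord_fun (c *: u) (h * g)%g + coord_fun v _) orbit_restr_scaleE.
Qed.
Fact right_translate_rational : rational right_translate.
Proof.
apply: rational_criterion right_translate1 right_translateM right_translate_linear _.
move=> f; have [n [b [c bc]]] := rational_coef (coord_module_algebra mulg_action) f.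
exists n, b, c => g; rewrite /right_translate [LHS]bc.
apply: eq_bigr => i _; apply/coord_eqP => h.
by rewrite orbit_restr_scaleE coordZE.
Qed.
Definition right_translate_module := RationalModule
  right_translate1 right_translateM right_translate_linear right_translate_rational.
(** Compatibility amounts to x (h g) = (x h) g. *)
Fact right_translateZ g (r : coord_ring X) (f : orbit_module) :
  right_translate_module g (r *: f)
  = coord_module_algebra act g r *: (right_translate_module g f : orbit_module).
Proof.
apply/coord_eqP => h; rewrite [RHS]orbit_scaleE /=.
by rewrite -[LHS]/(r (act x (h * g)%g) * coord_fun f (h * g)%g) ractM.
Qed.
Definition orbit_grmodule : grmodule (coord_module_algebra act) :=
  GRModule right_translateZ.

Definition comorphism_range : {pred orbit_grmodule} :=
  [pred f | `[< exists r, f = pi r >]].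
Fact comorphism_range_closed : GRing.submod_closed comorphism_range.
Proof.
split; first by apply/asboolP; exists 0; rewrite rmorph0.
move=> r _ _ /asboolP[s ->] /asboolP[t ->]; apply/asboolP; exists (r * s + t).
by rewrite rmorphD rmorphM.
Qed.
Fact comorphism_range_stable g f : f \in comorphism_range ->
  (grm_act orbit_grmodule g f : orbit_grmodule) \in comorphism_range.
Proof.
move=> /asboolP[r ->]; apply/asboolP; exists (translate act g r).
by apply/coord_eqP => h; rewrite /= ractM.
Qed.

Lemma comorphism_surj : unipotent_action act -> linearly_reductive_action act ->
  forall f : coord_ring G, exists r : coord_ring X, f = pi r.
Proof.
move=> uni red f; apply/asboolP.
apply: (@generated_by_fixed _ _ _ _ uni red orbit_grmodule
  (StableSubmodule comorphism_range_closed comorphism_range_stable)).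
(* Invariance evaluated at 1 reads f(1 g) = f(1): f is constant, and constants come from k[X]. *)
move=> {}f ffix; apply/asboolP; exists (coord_cst X (coord_fun f 1%g)).
apply/coord_eqP => g /=.
by have /coord_eqP/(_ 1%g) := ffix g; rewrite /= mul1g.
Qed.
End OrbitModule.

(** * Points as characters of the coordinate ring *)

Section Points.
Variables (k : fieldType) (X : affineVarietyType k).

Definition coord_eval (x : X) (f : coord_ring X) : k^o := f x.
Fact coord_eval_is_zmod_morphism x : zmod_morphism (coord_eval x).
Proof. by []. Qed.
Fact coord_eval_is_monoid_morphism x : monoid_morphism (coord_eval x).
Proof. by []. Qed.
Fact coord_eval_is_scalable x : scalable (coord_eval x).
Proof. by []. Qed.
HB.instance Definition _ x := GRing.isZmodMorphism.Build (coord_ring X) k^o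
  (coord_eval x) (coord_eval_is_zmod_morphism x).
HB.instance Definition _ x := GRing.isMonoidMorphism.Build (coord_ring X) k^o
  (coord_eval x) (coord_eval_is_monoid_morphism x).
HB.instance Definition _ x := GRing.isScalable.Build k (coord_ring X) k^o *:%R
  (coord_eval x) (coord_eval_is_scalable x).

(** Evaluation at x is then also evaluation at y, and a character comes from only one point. *)
Lemma coord_separates (x y : X) : (forall f : coord_ring X, f x = f y) -> x = y.
Proof.
move=> xy; have [z [_ zU]] := coord_points (coord_eval x).
by rewrite -(zU x) // (zU y).
Qed.

End Points.

(** * Closedness of the orbit and the isomorphism with G *)

Section ClosedOrbit.
Variables (k : fieldType) (G : affineGroupType k) (X : affineVarietyType k).
Variables (act : right_action G X) (x : X).
Local Notation pi := (pullback (orbit_mor act x)).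
Hypothesis pi_surj : forall f : coord_ring G, exists r : coord_ring X, f = pi r.

(* A point y of X at which the kernel of pi vanishes is a character of k[G],  *)
(* i.e. a point g of G, and y = x g.                                          *)
Lemma orbit_closed : zariski_closed (ract_orbit act x).
Proof.
exists [set r | pi r = 0]; apply/seteqP; split=> [_ [g _ <-] r /= r0|y yP].
  by have /coord_eqP/(_ g) := r0.
pose lift (f : coord_ring G) := projT1 (cid (pi_surj f)).
(* Two preimages of f differ by an element of the kernel of pi, which vanishes at y; so the value at
   y does not depend on the preimage. *)
have chiE r f : f = pi r -> lift f y = r y.
  rewrite /lift; case: cid => s /= -> /eqP; rewrite -subr_eq0 -raddfB => /eqP.
  by move=> /yP /eqP; rewrite coordBE subr_eq0 => /eqP.
pose chi (f : coord_ring G) : k^o := lift f y.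
have chi_pi r : chi (pi r) = r y by exact: chiE.
have chi_zmod : zmod_morphism chi.
  move=> f g; have [[r ->] [s ->]] := (pi_surj f, pi_surj g).
  by rewrite -raddfB !chi_pi.
have chi_monoid : monoid_morphism chi.
  split=> [|f g]; first by rewrite -(rmorph1 pi) chi_pi.
  have [[r ->] [s ->]] := (pi_surj f, pi_surj g).
  by rewrite -rmorphM !chi_pi.
have chi_scal : scalable chi.
  by move=> c f; have [r ->] := pi_surj f; rewrite -linearZ !chi_pi.
pose m1 := GRing.isZmodMorphism.Build _ _ chi chi_zmod.
pose m2 := GRing.isMonoidMorphism.Build _ _ chi chi_monoid.
pose m3 := GRing.isScalable.Build k _ _ *:%R chi chi_scal.
pose chiL : {lrmorphism coord_ring G -> k^o} := HB.pack chi m1 m2 m3.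
have [g [gP _]] := coord_points chiL.
(* For every r, r(x g) = (pi r)(g) = chi(pi r) = r(y). *)
exists g => //; apply: coord_separates => r.
by rewrite -chi_pi -[RHS]/(chiL (pi r)) gP.
Qed.

Local Notation O := (subvariety (orbit_subset orbit_closed)).

Definition orbit_map (g : G) : O := exist _ (act x g) (imageT (act x) g).
Fact orbit_map_regular (f : coord_ring O) : f \o orbit_map \in regular.
Proof.
have [r ->] := pullback_incl_surj f; exact: (coord_ringP (pi r)).
Qed.
Definition orbit_map_mor : variety_morphism G O := Morphism orbit_map_regular.

(** Every regular function on G factors through g |-> x g, and these functions separate the points
    of G. *)
Lemma orbit_map_inj : injective orbit_map.
Proof.
move=> g h /(congr1 (@sub_pt _ _ _)) /= gh; apply: coord_separates => f.
by have [r ->] := pi_surj f; rewrite /= gh.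
Qed.

Lemma orbit_map_iso : variety_isomorphism orbit_map_mor.
Proof.
have orb (y : O) : exists g, orbit_map g = y.
  by have [g _ gy] := sub_ptP y; exists g; apply: sub_pt_inj.
pose psi (y : O) := projT1 (cid (orb y)).
have psiK : cancel psi orbit_map by rewrite /psi => y; case: cid.
have psi_regular (f : coord_ring G) : f \o psi \in regular.
  have [r ->] := pi_surj f.
  (* Regularity of the inverse: a function pi r on G is carried to the restriction of r to the
     orbit. *)
  have -> : pi r \o psi = pullback (sub_incl (orbit_subset orbit_closed)) r.
    by apply/funext => y /=; rewrite -[in RHS](psiK y).
  exact: coord_ringP.
exists (Morphism psi_regular); split=> // g.
by apply: orbit_map_inj; exact: psiK.
Qed.
End ClosedOrbit.

Theorem theorem7p11 (k : closedFieldType) (G : affineGroupType k)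
    (X : affineVarietyType k) (act : right_action G X) :
  separable_action act -> unipotent_action act -> linearly_reductive_action act ->
  forall x : X, exists clo : zariski_closed (ract_orbit act x),
    exists phi : variety_morphism G (subvariety (orbit_subset clo)),
      variety_isomorphism phi /\
      forall g h : G, sub_pt (phi (g * h)%g) = act (sub_pt (phi g)) h.
Proof.
move=> _ uni red x; have surj := comorphism_surj x uni red.
exists (orbit_closed surj), (orbit_map_mor surj); split=> [|g h].
  exact: orbit_map_iso.
exact: ractM.
Qed.
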